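(* There is an RB-function $f$ with the following property: for every structurally live conservative Petri net $A$ of dimension $d$ there is a live configuration $x\in\mathbb{N}^d$ of $A$ with $\|x\|\leq f(\|A\|,d)$.
   Context: A Petri net of dimension $d$ ($d$-dim net) $A$ is a finite set of actions $a=(a_-,a_+)\in\mathbb{N}^d\times\mathbb{N}^d$; $\|A\|=\max_{a\in A}\max\{\|a_-\|,\|a_+\|\}$, where $\|x\|=\max_i|x(i)|$ for vectors (and $\max\emptyset=0$). A configuration is a vector $x\in\mathbb{N}^d$. For an action $a$, $x\xrightarrow{a}y$ if $x=c+a_-$ and $y=c+a_+$ for some $c\in\mathbb{N}^d$; $\xrightarrow{*}$ is the reflexive-transitive closure of the union of these relations. The displacement is $\Delta(a)=a_+-a_-$. $A$ is conservative if there is $w\in(\mathbb{N}_+)^d$ with $\langle \Delta(a),w\rangle=0$ for all $a\in A$. A configuration $x$ is live if for every $a\in A$ and every $x'$ with $x\xrightarrow{*}x'$ there is $y$ with $x'\xrightarrow{*}y$ and $y\geq a_-$ (componentwise). $A$ is structurally live if it has a live configuration. A function $f:\mathbb{N}^2\to\mathbb{N}$ is an RB-function if there are $c\in\mathbb{N}$ and a polynomial $p:\mathbb{N}\to\mathbb{N}$ with $f(m,d)\leq (c+m)^{2^{p(d)}}$ for all $m,d\in\mathbb{N}$. *)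

(* Defs.v *)
From Stdlib Require Import List Relations.
From mathcomp Require Import all_boot all_order all_algebra.
Set Implicit Arguments. Unset Strict Implicit. Unset Printing Implicit Defensive.
Import GRing.Theory Num.Theory.

Definition vec (d : nat) := 'I_d -> nat.
(* An action a = (a_-, a_+). *)
Definition action (d : nat) := (vec d * vec d)%type.
(* A d-dim Petri net: a finite set of actions (given as a finite list). *)
Definition net (d : nat) := list (action d).

(* ||x|| = max_i |x(i)| (max over empty = 0). *)
Definition vnorm (d : nat) (x : vec d) : nat := \max_(i < d) x i.

Definition netnorm (d : nat) (A : net d) : nat :=
  \max_(a <- A) maxn (vnorm a.1) (vnorm a.2).

Definition step (d : nat) (a : action d) (x y : vec d) : Prop :=
  exists c : vec d, (forall i, x i = c i + a.1 i) /\ (forall i, y i = c i + a.2 i).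

Definition step_net (d : nat) (A : net d) (x y : vec d) : Prop :=
  exists a, In a A /\ step a x y.

Definition reach (d : nat) (A : net d) : relation (vec d) :=
  clos_refl_trans (vec d) (step_net A).

Definition displacement (d : nat) (a : action d) (i : 'I_d) : int :=
  (a.2 i)%:Z - (a.1 i)%:Z.

Definition conservative (d : nat) (A : net d) : Prop :=
  exists w : 'I_d -> nat, (forall i, (0 < w i)%N) /\
    forall a, In a A -> (\sum_(i < d) displacement a i * (w i)%:Z = 0)%R.

Definition live (d : nat) (A : net d) (x : vec d) : Prop :=
  forall a, In a A -> forall x', reach A x x' ->
    exists y, reach A x' y /\ forall i, (a.1 i <= y i)%N.

Definition structurally_live (d : nat) (A : net d) : Prop :=
  exists x, live A x.

Definition poly_fun (p : nat -> nat) : Prop :=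
  exists cs : seq nat, forall n, p n = \sum_(i < size cs) nth 0 cs i * n ^ i.

Definition RB_function (f : nat -> nat -> nat) : Prop :=
  exists (c : nat) (p : nat -> nat), poly_fun p /\
    forall m d, f m d <= (c + m) ^ (2 ^ p d).

(* Main.v *)
(** Restrict a large recurrent live configuration x to a set J of coordinates on which all runs stay
small, the other coordinates being above a threshold (if a run exceeds the bound on J, drop the
coordinate where it does and lower the threshold; this happens at most d times). The restriction to
J is a finite strongly connected graph. Inserting its cycles into a tour through all its states,
whose displacement is undone by a real return path, makes every cycle displacement the effect of a
short closed walk at x, so that large configurations z reach each large z + sum y_f f with
f ranging over cycle displacements.

Liveness can then be preserved while z is decreased. If z - g reaches a configuration u from which
some action cannot be enabled, then by Rackoff's bound the set S of the large coordinates of u can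
be raised without enabling it. The equations "g plus a combination of cycles is supported by S",
taken simultaneously for all S that can occur, have a small nonzero solution g <= z as soon as z has
a coordinate that is too large (pigeonhole on the roundings of (k/n)y for a large solution y). For this
g, z reaches z - g + q with q supported by S, hence u + q, which contradicts the liveness of z. *)

Require Import Defs.
From Stdlib Require Import List Relations.
From mathcomp Require Import all_boot all_order all_algebra.
From mathcomp Require Import boolp zify ring.
Set Implicit Arguments. Unset Strict Implicit. Unset Printing Implicit Defensive.
Import Order.TTheory GRing.Theory Num.Theory.
Local Open Scope ring_scope.

Lemma pigeonhole n (F : finType) (f : 'I_n -> F) :
  (#|F| < n)%N -> exists i j : 'I_n, (i < j)%N /\ f i = f j.
Proof.
move=> ltFn.
have /injectivePn[i [j neq_ij eqf]] : ~~ injectiveb f.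
  apply/negP=> /injectiveP/leq_card; rewrite card_ord; lia.
have [lt_ij|lt_ji|/val_inj eq_ij] := ltngtP i j; last by rewrite eq_ij eqxx in neq_ij.
- by exists i, j.
- by exists j, i.
Qed.

(** * Small solutions of linear Diophantine systems *)

Section Diophantine.

Variables (U E : finType) (a : U -> E -> int) (A : nat).
Hypothesis leaA : forall u e, `|a u e| <= A%:Z.

Definition comb (y : U -> nat) (e : E) : int := \sum_u (y u)%:Z * a u e.

Definition dbound (c : nat) : nat := ((2 * (c + #|U| * A)).+1 ^ #|E|)%N.

Lemma combB (y w : U -> nat) e : (forall u, (w u <= y u)%N) ->
  comb (fun u => (y u - w u)%N) e = comb y e - comb w e.
Proof.
move=> lewy; rewrite /comb -sumrB; apply: eq_bigr => u _.
by rewrite -mulrBl; congr (_ * _); have := lewy u; lia.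
Qed.

Lemma floor_comb n t (y : U -> nat) e : (0 < n)%N ->
  `|n%:Z * comb (fun u => (t * y u %/ n)%N) e - t%:Z * comb y e|
    <= n%:Z * (#|U| * A)%N%:Z.
Proof.
move=> n_gt0; rewrite /comb !mulr_sumr -sumrB.
apply: le_trans (ler_norm_sum _ _ _) _.
have -> : n%:Z * (#|U| * A)%N%:Z = \sum_(u : U) n%:Z * A%:Z.
  by rewrite sumr_const -mulr_natl PoszM; ring.
apply: ler_sum => u _.
have -> : n%:Z * ((t * y u %/ n)%N%:Z * a u e) - t%:Z * ((y u)%:Z * a u e)
    = - ((t * y u %% n)%N%:Z * a u e).
  by rewrite 2!mulrA -PoszM -PoszM {2}(divn_eq (t * y u) n); lia.
rewrite normrN normrM; apply: ler_pM => //; have := ltn_pmod (t * y u) n_gt0; lia.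
Qed.

(** With [n = y j], the roundings of [(t / n) y] for [t <= dbound c] have combination values of size
    at most [c + #|U| * A], and [dbound c] counts the vectors of such values. So two roundings
    collide, and their difference is homogeneous. Coordinate [j] of the rounding at [t] is exactly
    [t], which bounds [w j] on both sides. *)
Lemma hom_sub_core c (y : U -> nat) j :
    (forall e, `|comb y e| <= c%:Z) -> (dbound c < y j)%N ->
  exists w : U -> nat, [/\ forall u, (w u <= y u)%N, forall e, comb w e = 0
    & (0 < w j <= dbound c)%N].
Proof.
move=> leyc lt_j; set n := y j; have n_gt0 : (0 < n)%N by rewrite /n; lia.
pose fl t u := (t * y u %/ n)%N.
set c' := (c + #|U| * A)%N.
have bd t e : (t <= n)%N -> `|comb (fl t) e| <= c'%:Z.
  move=> letn; have := floor_comb t y e n_gt0; have := leyc e.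
  rewrite -/(fl t) /c' PoszD; nia.
pose f (t : 'I_(dbound c).+1) : {ffun E -> 'I_(2 * c').+1} :=
  [ffun e => inord (absz (comb (fl t) e + c'%:Z))].
have [|t1 [t2 [lt12 eqf]]] := @pigeonhole _ _ f.
  by rewrite card_ffun card_ord.
have let1 : (t1 <= n)%N by have := ltn_ord t1; rewrite /n; lia.
have let2 : (t2 <= n)%N by have := ltn_ord t2; rewrite /n; lia.
have mono u : (fl t1 u <= fl t2 u)%N by apply: leq_div2r; rewrite leq_mul2r ltnW ?orbT.
exists (fun u => (fl t2 u - fl t1 u)%N); split.
- move=> u; apply: leq_trans (leq_subr _ _) _.
  by rewrite -[leqRHS](@mulKn _ n) // leq_div2r // leq_mul2r let2 orbT.
- move=> e; rewrite combB //; have /ffunP/(_ e) := eqf; rewrite !ffunE => /(congr1 (@nat_of_ord _)).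
  have := bd _ e let1; have := bd _ e let2.
  by move=> b1 b2; rewrite !inordK; lia.
- by rewrite /fl -/n !mulnK //; have := ltn_ord t2; lia.
Qed.

(** Homogeneous solutions are subtracted while some unknown is too large; the combinations do not
    change, so the hypothesis persists. *)
Lemma small_sol c (y : U -> nat) : (forall e, `|comb y e| <= c%:Z) ->
  exists y' : U -> nat, [/\ forall u, (y' u <= y u)%N,
    forall e, comb y' e = comb y e & forall u, (y' u <= dbound c)%N].
Proof.
have [n] := ubnP (\sum_u y u)%N; elim: n y => // n IHn y; rewrite ltnS => le_n leyc.
have [/forallP small|/forallPn[j]] := boolP [forall u, y u <= dbound c]%N.
  by exists y.
rewrite -ltnNge => /(hom_sub_core leyc)[w [lewy w0 /andP[wj_gt0 _]]].
have [||y' [ley' eqy' ley'c]] := IHn (fun u => y u - w u)%N.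
- apply: leq_trans le_n; rewrite (bigD1 j) //= [X in (_ < X)%N](bigD1 j) //=.
  have: (\sum_(i | i != j) (y i - w i) <= \sum_(i | i != j) y i)%N.
    by apply: leq_sum => i _; apply: leq_subr.
  have := lewy j; lia.
- by move=> e; rewrite combB // w0 subr0.
exists y'; split=> // [u|e]; first by have := ley' u; lia.
by rewrite eqy' combB // w0 subr0.
Qed.

(** The bound on [w] is free of [c]: a homogeneous solution has combination values 0 and can be
    split again by [hom_sub_core] with [c = 0]. Hence [descent_step] may use a [c] that depends on
    the bound on [w]. *)
Lemma hom_sub c (y : U -> nat) j :
    (forall e, `|comb y e| <= c%:Z) -> (dbound c < y j)%N ->
  exists w : U -> nat, [/\ forall u, (w u <= y u)%N, forall e, comb w e = 0,
    (0 < w j)%N & forall u, (w u <= dbound 0)%N].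
Proof.
move=> leyc /(hom_sub_core leyc)[w [lewy w0 /andP[wj_gt0 _]]].
have [n] := ubnP (\sum_u w u)%N; elim: n w lewy w0 wj_gt0 => // n IHn w lewy w0 wj_gt0; rewrite ltnS => le_n.
have [/forallP small|/forallPn[i]] := boolP [forall u, w u <= dbound 0]%N.
  by exists w.
rewrite -ltnNge => lt_i.
have lew0 e : `|comb w e| <= 0%:Z by rewrite w0.
have [v [levw v0 /andP[vi_gt0 levi]]] := hom_sub_core lew0 lt_i.
have sum_lt (f : U -> nat) : (forall u, f u <= w u)%N -> (f i < w i)%N ->
    (\sum_u f u < n)%N.
  move=> lefw lt_fi; apply: leq_trans le_n.
  rewrite (bigD1 i) //= [X in (_ < X)%N](bigD1 i) //=.
  have: (\sum_(u | u != i) f u <= \sum_(u | u != i) w u)%N by apply: leq_sum.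
  lia.
(* The first case is [v j = 0]: then [w - v] stays positive at [j]. In the second, [v] itself is a
   smaller solution, since [v i <= dbound 0 < w i]. *)
have [vj_gt0|vj0] := posnP (v j).
  apply: (IHn (fun u => w u - v u)%N) => [u|e||]; first by have := lewy u; lia.
  - by rewrite combB // w0 v0.
  - by rewrite vj_gt0 subn0.
  - by apply: sum_lt => [u|]; rewrite ?leq_subr //; lia.
apply: (IHn v) => // [u|]; first by have := lewy u; have := levw u; lia.
by apply: sum_lt => //; lia.
Qed.

End Diophantine.

(** * Runs tested on a subset of the coordinates *)

Section Runs.

Variables (d : nat) (T : finType) (pre dl : T -> {ffun 'I_d -> int}) (m : nat).
Local Notation V := {ffun 'I_d -> int}.
Hypothesis pre_bound : forall t (i : 'I_d), 0 <= pre t i <= m%:Z.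
Hypothesis post_bound : forall t (i : 'I_d), 0 <= pre t i + dl t i <= m%:Z.

Implicit Types (J : {set 'I_d}) (z x g q : V) (w c r : seq T) (t : T) (i : 'I_d) (b : nat).

Lemma addfE z x i : (z + x) i = z i + x i. Proof. exact: ffunE. Qed.

Lemma zerofE i : (0 : V) i = 0. Proof. exact: ffunE. Qed.

Definition disp w : V := \sum_(t <- w) dl t.

Definition firable J z t := [forall i in J, pre t i <= z i].

Lemma firableP J z t : reflect (forall i, i \in J -> pre t i <= z i) (firable J z t).
Proof. exact: forall_inP. Qed.

(* Only the coordinates in J are tested: the others may become negative. *)
Fixpoint en J z w : bool :=
  if w is t :: w' then firable J z t && en J (z + dl t) w' else true.

Definition agree J z z' := forall i, i \in J -> z i = z' i.

Lemma disp_nil : disp [::] = 0. Proof. exact: big_nil. Qed.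

Lemma disp_cons t w : disp (t :: w) = dl t + disp w.
Proof. exact: big_cons. Qed.

Lemma disp_cat w1 w2 : disp (w1 ++ w2) = disp w1 + disp w2.
Proof. exact: big_cat. Qed.

Lemma en_cat J z w1 w2 : en J z (w1 ++ w2) = en J z w1 && en J (z + disp w1) w2.
Proof.
elim: w1 z => [|t w1 IHw] z /=; first by rewrite disp_nil addr0.
by rewrite IHw disp_cons addrA andbA.
Qed.

Lemma en_mono J J' z z' w : J' \subset J -> (forall i, i \in J' -> z i <= z' i) ->
  en J z w -> en J' z' w.
Proof.
move=> sJ; elim: w z z' => //= t w IHw z z' lez /andP[/firableP pz ez].
apply/andP; split; last first.
  by apply: IHw ez => i iJ; rewrite !addfE lerD2r lez.
apply/firableP=> i iJ; apply: le_trans (lez _ iJ).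
by apply: pz; rewrite (subsetP sJ).
Qed.

Lemma en_agree J z z' w : agree J z z' -> en J z w -> en J z' w.
Proof. by move=> eqz; apply: en_mono => // i /eqz ->. Qed.

Lemma dl_bound t i : `|dl t i| <= m%:Z.
Proof. have := pre_bound t i; have := post_bound t i; lia. Qed.

Lemma disp_bound w i : `|disp w i| <= (m * size w)%N%:Z.
Proof.
elim: w => [|t w IHw]; first by rewrite disp_nil zerofE.
rewrite disp_cons addfE /= mulnS; have := dl_bound t i; lia.
Qed.

Lemma en_ext J J' z w : en J z w ->
  (forall i, i \in J' -> i \notin J -> (m * size w)%N%:Z <= z i) -> en J' z w.
Proof.
elim: w z => //= t w IHw z /andP[/firableP pz ez] big_z; apply/andP; split.
  apply/firableP=> i iJ'; have [/pz//|iJ] := boolP (i \in J).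
  by have := big_z _ iJ' iJ; have := pre_bound t i; rewrite /= mulnS; lia.
apply: IHw ez _ => i iJ' iJ; have := big_z _ iJ' iJ; have := dl_bound t i.
rewrite addfE /= mulnS; lia.
Qed.

Lemma en_ge0 J z w i : en J z w -> i \in J -> 0 <= z i -> 0 <= (z + disp w) i.
Proof.
move=> + iJ; elim: w z => [|t w IHw] z /=; first by rewrite disp_nil addr0.
case/andP=> /firableP/(_ i iJ) pz ez _; rewrite disp_cons addrA; apply: IHw ez _.
by rewrite addfE; have := post_bound t i; lia.
Qed.

(** * Runs inside a box and their cycles *)

Definition inbox b J z := [forall i in J, 0 <= z i <= b%:Z].

Lemma inboxP b J z : reflect (forall i, i \in J -> 0 <= z i <= b%:Z) (inbox b J z).
Proof. exact: forall_inP. Qed.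

Fixpoint boxed b J z w : bool :=
  inbox b J z && (if w is t :: w' then boxed b J (z + dl t) w' else true).

Lemma boxed_head b J z w : boxed b J z w -> inbox b J z.
Proof. by case: w => /= [|t w] /andP[]. Qed.

Lemma boxed_cat b J z w1 w2 :
  boxed b J z (w1 ++ w2) = boxed b J z w1 && boxed b J (z + disp w1) w2.
Proof.
elim: w1 z => [|t w1 IHw] z /=; last by rewrite IHw disp_cons addrA andbA.
rewrite disp_nil addr0 andbT; case: (boolP (boxed _ _ _ _)) => [/boxed_head ->//|_].
by rewrite andbF.
Qed.

Lemma inbox_agree b J z z' : agree J z z' -> inbox b J z -> inbox b J z'.
Proof. by move=> eqz /inboxP inz; apply/inboxP=> i iJ; rewrite -eqz ?inz. Qed.

Lemma agreeDr J z z' x : agree J z z' -> agree J (z + x) (z' + x).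
Proof. by move=> eqz i iJ; rewrite !addfE eqz. Qed.

Lemma boxed_agree b J z z' w : agree J z z' -> boxed b J z w -> boxed b J z' w.
Proof.
elim: w z z' => /= [|t w IHw] z z' eqz /andP[inz bw]; rewrite (inbox_agree eqz inz) //=.
exact: IHw (agreeDr _ eqz) bw.
Qed.

Lemma boxed_last b J z w : boxed b J z w -> inbox b J (z + disp w).
Proof.
elim: w z => /= [|t w IHw] z /andP[inz]; first by rewrite disp_nil addr0.
by move/IHw; rewrite disp_cons addrA.
Qed.

Definition nstates b : nat := (b.+1 ^ d)%N.

Definition state b J z : {ffun 'I_d -> 'I_b.+1} :=
  [ffun i => if i \in J then inord `|z i|%N else ord0].

Lemma state_inj b J z z' : inbox b J z -> inbox b J z' ->
  state b J z = state b J z' -> agree J z z'.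
Proof.
move=> /inboxP inz /inboxP inz' /ffunP eqs i iJ.
have := eqs i; rewrite !ffunE iJ => /(congr1 (@nat_of_ord _)).
by have := inz _ iJ; have := inz' _ iJ; move=> b1 b2; rewrite !inordK; lia.
Qed.

Lemma card_state b : #|{: {ffun 'I_d -> 'I_b.+1}}| = nstates b.
Proof. by rewrite card_ffun !card_ord. Qed.

Lemma cut_cycle b J z w : boxed b J z w -> (nstates b < size w)%N ->
  exists w1 c w2, [/\ w = w1 ++ c ++ w2, (0 < size c <= nstates b)%N
    & forall i, i \in J -> disp c i = 0].
Proof.
move=> bw ltw.
have [|k1 [k2 [lt12 eqs]]] := @pigeonhole (nstates b).+1 _
    (fun k => state b J (z + disp (take k w))); first by rewrite card_state.
have inb k : inbox b J (z + disp (take k w)).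
  by apply: boxed_last; move: bw; rewrite -{1}(cat_take_drop k w) boxed_cat => /andP[].
have lt2 := ltn_ord k2.
have tk : take k2 w = take k1 w ++ drop k1 (take k2 w).
  by rewrite -[X in X ++ _](take_takel w (ltnW lt12)) cat_take_drop.
exists (take k1 w), (drop k1 (take k2 w)), (drop k2 w); split.
- by rewrite catA -tk cat_take_drop.
- by rewrite size_drop size_take; case: ifP; lia.
move=> i iJ; have := state_inj (inb k1) (inb k2) eqs iJ.
by rewrite [in X in X -> _]tk disp_cat addrA !addfE; lia.
Qed.

(* Displacements of short cycles of the graph of J-restrictions of configurations reachable from z. *)
Definition cyc b J z g := exists w c,
  [/\ en J z (w ++ c), (size c <= nstates b)%N, forall i, i \in J -> disp c i = 0 & g = disp c].

(** Short cycles are cut out one after another. They vanish on [J], so the rest of the run remains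
    enabled and boxed, and the part of the run in front of each makes it an instance of [cyc]. *)
Lemma decomp b J z w : en J z w -> boxed b J z w ->
  exists w' (gs : seq V), [/\ (size w' <= nstates b)%N, en J z w',
    disp w = disp w' + \sum_(g <- gs) g & forall g, g \in gs -> cyc b J z g].
Proof.
have [n] := ubnP (size w); elim: n w => // n IHn w; rewrite ltnS => le_n ew bw.
have [small|large] := leqP (size w) (nstates b).
  by exists w, [::]; rewrite big_nil addr0.
have [w1 [c [w2 [eqw /andP[c_gt0 lec] c0]]]] := cut_cycle bw large.
move: ew bw le_n; rewrite eqw !en_cat !boxed_cat !size_cat.
move=> /and3P[ew1 ec ew2] /and3P[bw1 bc bw2] le_n.
have eqz : agree J (z + disp w1 + disp c) (z + disp w1).
  by move=> i iJ; rewrite addfE c0 // addr0.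
have [|||w' [gs [lew' ew' eqd cyc_gs]]] := IHn (w1 ++ w2).
- by rewrite size_cat; lia.
- by rewrite en_cat ew1; apply: en_agree ew2.
- by rewrite boxed_cat bw1; apply: boxed_agree bw2.
exists w', (disp c :: gs); split=> //.
- rewrite big_cons !disp_cat; move: eqd; rewrite disp_cat => eqd.
  by rewrite addrCA eqd addrCA.
- move=> g; rewrite inE => /predU1P[->|/cyc_gs//].
  by exists w1, c; rewrite en_cat ew1 ec.
Qed.

Lemma sum_cyc0 b J z (gs : seq V) i : (forall g, g \in gs -> cyc b J z g) -> i \in J ->
  (\sum_(g <- gs) g) i = 0.
Proof.
move=> cyc_gs iJ; rewrite big_seq; elim/big_rec: _ => [|g y /cyc_gs[w [c [_ _ c0 ->]]] y0].
  by rewrite zerofE.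
by rewrite addfE c0 // y0.
Qed.

Lemma decomp_agree b J z w : en J z w -> boxed b J z w ->
  exists w', [/\ (size w' <= nstates b)%N, en J z w' & agree J (disp w) (disp w')].
Proof.
move=> ew bw; have [w' [gs [lew' ew' -> cyc_gs]]] := decomp ew bw.
by exists w'; split=> // i iJ; rewrite addfE (sum_cyc0 cyc_gs iJ) addr0.
Qed.

(** * Leaving a box, and covering by short runs *)

Lemma agreeDl J z x x' : agree J x x' -> agree J (z + x) (z + x').
Proof. by move=> eqx i iJ; rewrite !addfE eqx. Qed.

(** Before the first exit the run is boxed and can be shortened to [nstates b] steps without
    changing its effect on [J]; the leaving step is then appended. As [wa] is the unshortened
    prefix, the remainder [w2] can follow [w1] as far as [J] is concerned. *)
Lemma exceed b J z w : en J z w -> (forall i, i \in J -> 0 <= z i) ->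
  boxed b J z w \/ exists w1 wa w2 i, [/\ (size w1 <= (nstates b).+1)%N, en J z w1,
    i \in J, b%:Z < (z + disp w1) i & w = wa ++ w2 /\ agree J (z + disp w1) (z + disp wa)].
Proof.
move=> ew z_ge0.
elim/last_ind: w ew => [|w t IHw].
  move=> _; have [inz|/forall_inPn[i iJ]] := boolP (inbox b J z); first by left; rewrite /= inz.
  rewrite z_ge0 //= -ltNge => lt_i; right; exists [::], [::], [::], i.
  by rewrite disp_nil addr0; split.
rewrite -cats1 en_cat /= andbT => /andP[ew pt].
have [bw|[w1 [wa [w2 [i [le1 e1 iJ lt_i [eqw eqz]]]]]]] := IHw ew; last first.
  by right; exists w1, wa, (w2 ++ [:: t]), i; split=> //; split; rewrite // eqw catA.
have et : en J (z + disp w) [:: t] by rewrite /= pt.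
have [inz|/forall_inPn[i iJ]] := boolP (inbox b J (z + disp w + dl t)).
  by left; rewrite boxed_cat bw /= inz (boxed_last bw).
have -> : dl t = disp [:: t] by rewrite disp_cons disp_nil addr0.
rewrite (en_ge0 et) //= => [|]; last by rewrite (en_ge0 ew) // z_ge0.
rewrite -ltNge => lt_i; right.
have [w' [lew' ew' eqd]] := decomp_agree ew bw.
have eqz : agree J (z + disp w) (z + disp w') by apply: agreeDl.
exists (w' ++ [:: t]), (w ++ [:: t]), [::], i; split=> //.
- by rewrite size_cat addn1.
- by rewrite en_cat ew'; apply: en_agree et.
- by rewrite disp_cat addrA -(agreeDr _ eqz).
- rewrite cats0; split=> //; rewrite !disp_cat !addrA => j jJ.
  by rewrite -(agreeDr _ eqz).
Qed.

(* Rackoff's bound on the length of shortest covering runs with k tested coordinates. *)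
Fixpoint rk k : nat :=
  if k is k'.+1 then ((nstates (m * (rk k').+1)).+1 + rk k')%N else 0.

(** If the run stays in the box, its cycles are removed. Otherwise coordinate [i] exceeds
    [m * (rk k).+1], and the covering run that induction gives for [J :\ i], of at most [(rk k).+1]
    steps, cannot exhaust it. *)
Lemma rackoff k J z w t : (#|J| <= k)%N -> (forall i, i \in J -> 0 <= z i) ->
  en J z (w ++ [:: t]) ->
  exists2 w', (size w' <= rk k)%N & en J z (w' ++ [:: t]).
Proof.
elim: k J z w => [|k IHk] J z w leJ z_ge0 ewt.
  have J0 : J = set0 by apply/eqP; rewrite -cards_eq0; lia.
  by exists [::] => //=; rewrite andbT; apply/firableP=> i; rewrite J0 inE.
move: (ewt); rewrite en_cat => /andP[ew et].
set b := (m * (rk k).+1)%N.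
have [bw|[w1 [wa [w2 [i [le1 e1 iJ lt_i [eqw eqz]]]]]]] := exceed b ew z_ge0.
  have [w' [lew' ew' eqd]] := decomp_agree ew bw.
  exists w'; first by rewrite /= -/b; lia.
  by rewrite en_cat ew'; apply: en_agree et; apply: agreeDl.
have sJ : J :\ i \subset J by apply: subsetDl.
have [|||w2' le2 e2] := IHk (J :\ i) (z + disp w1) w2.
- by move: leJ; rewrite (cardsD1 i J) iJ.
- by move=> j /(subsetP sJ) jJ; apply: en_ge0 e1 jJ (z_ge0 _ jJ).
- move: ewt; rewrite eqw -catA en_cat => /andP[_].
  by apply: en_mono => // j /(subsetP sJ) jJ; rewrite eqz.
exists (w1 ++ w2'); first by rewrite size_cat /= -/b; lia.
rewrite -catA en_cat e1; apply: en_ext e2 _ => j jJ.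
rewrite !inE jJ andbT negbK => /eqP ->; apply: le_trans (ltW lt_i).
by rewrite size_cat addn1 lez_nat leq_mul2l ltnS le2 orbT.
Qed.

(** A covering run from [z + q] is enabled at [z] on the coordinates where [q] vanishes, hence so is
    one of at most [(rk d).+1] steps; on the other coordinates [z] is large enough for that many
    steps. *)
Lemma uncoverable_raise z q t :
    (forall i, 0 <= z i) -> (forall i, 0 <= q i) ->
    (forall i, 0 < q i -> (m * (rk d).+1)%N%:Z <= z i) ->
    (forall w, ~~ en setT z (w ++ [:: t])) ->
  forall w, ~~ en setT (z + q) (w ++ [:: t]).
Proof.
move=> z_ge0 q_ge0 q_big unc w; apply/negP=> ew.
pose J := [set i | q i == 0].
have [|||w' lew' ew'] := @rackoff d J z w t.
- by rewrite -[leqRHS]card_ord max_card.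
- by [].
- by apply: en_mono ew => [|i]; rewrite ?subsetT // inE addfE => /eqP ->; rewrite addr0.
apply/negP: (unc w'); rewrite negbK; apply: en_ext ew' _ => i _.
rewrite inE => q_neq0; apply: le_trans (q_big i _); last by rewrite lt_def q_neq0 q_ge0.
by rewrite size_cat addn1 lez_nat leq_mul2l ltnS lew' orbT.
Qed.

(** * Live and recurrent configurations *)

Definition livec z := forall w, en setT z w ->
  forall t, exists w', en setT (z + disp w) (w' ++ [:: t]).

Definition recurrent z := forall w, en setT z w ->
  exists2 w', en setT (z + disp w) w' & disp w + disp w' = 0.

Lemma livec_reach z w : livec z -> en setT z w -> livec (z + disp w).
Proof.
move=> lz ew w1 ew1 t; have [|w' ew'] := lz (w ++ w1) _ t; first by rewrite en_cat ew.
by exists w'; rewrite disp_cat addrA in ew'.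
Qed.

Lemma recurrent_reach z w : recurrent z -> en setT z w -> recurrent (z + disp w).
Proof.
move=> rz ew w1 ew1; have [|w' ew'] := rz (w ++ w1); first by rewrite en_cat ew.
rewrite disp_cat -addrA in ew' * => eqd; exists (w' ++ w).
  by rewrite en_cat -!addrA ew' eqd addr0 ew.
by rewrite disp_cat addrA addrC.
Qed.

(** A configuration that is not recurrent has a run after which it is out of reach, so it can be
    struck off the list. *)
Lemma exists_recurrent (L : seq V) z : (forall w, en setT z w -> z + disp w \in L) ->
  exists2 w, en setT z w & recurrent (z + disp w).
Proof.
have [n] := ubnP (size L); elim: n L z => // n IHn L z; rewrite ltnS => le_n reachL.
have [rz|nrz] := EM (recurrent z); first by exists [::]; rewrite ?disp_nil ?addr0.
have [w ew nret] : exists2 w, en setT z w &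
    forall w', en setT (z + disp w) w' -> disp w + disp w' <> 0.
  apply: contrapT => nex; apply: nrz => w ew; apply: contrapT => nret; apply: nex.
  by exists w => // w' ew' eqd; apply: nret; exists w'.
have zL : z \in L by have := reachL [::] isT; rewrite disp_nil addr0.
have [||w' ew' rw'] := IHn [seq v <- L | v != z] (z + disp w).
- rewrite size_filter; apply: leq_trans le_n; rewrite -(count_predC (pred1 z) L).
  by rewrite -[X in (X < _)%N]add0n ltn_add2r -has_count has_pred1.
- move=> w1 ew1; rewrite mem_filter; apply/andP; split.
    apply/eqP=> eqz; apply: (nret _ ew1); apply: (@addrI _ z).
    by rewrite addr0 addrA.
  by rewrite -addrA -disp_cat reachL // en_cat ew.
exists (w ++ w'); first by rewrite en_cat ew.
by rewrite disp_cat addrA.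
Qed.

(** The weighted sum is invariant and the weights are positive, so it bounds each coordinate and
    only finitely many configurations are reachable. *)
Lemma conservative_recurrent (wt : 'I_d -> nat) z : (forall i, (0 < wt i)%N) ->
    (forall t, \sum_i dl t i * (wt i)%:Z = 0) -> (forall i, 0 <= z i) ->
  exists2 w, en setT z w & recurrent (z + disp w).
Proof.
move=> wt_gt0 wt0 z_ge0.
have disp0 w : \sum_i disp w i * (wt i)%:Z = 0.
  elim: w => [|t w IHw]; first by apply: big1 => i _; rewrite disp_nil zerofE mul0r.
  transitivity (\sum_i dl t i * (wt i)%:Z + \sum_i disp w i * (wt i)%:Z);
    last by rewrite wt0 IHw addr0.
  rewrite -big_split /=; apply: eq_bigr => i _.
  by rewrite disp_cons addfE mulrDl.
pose S := absz (\sum_i z i * (wt i)%:Z).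
apply: (@exists_recurrent [seq [ffun i => (f i)%:Z] : V
                          | f : {ffun 'I_d -> 'I_S.+1} <- enum {: {ffun 'I_d -> 'I_S.+1}}]).
move=> w ew; have y_ge0 i : 0 <= (z + disp w) i by apply: en_ge0 ew _ _; rewrite ?inE.
have leS i : (z + disp w) i <= S.
  have : \sum_i (z + disp w) i * (wt i)%:Z = S.
    under eq_bigr do rewrite addfE mulrDl.
    rewrite big_split /= disp0 addr0 /S gez0_abs //.
    by apply: sumr_ge0 => j _; rewrite mulr_ge0.
  move <-; rewrite (bigD1 i) //=; apply: ler_wpDr.
    by apply: sumr_ge0 => j _; rewrite mulr_ge0.
  by rewrite ler_peMr // lez_nat.
apply/mapP; exists [ffun i => inord (absz ((z + disp w) i))]; first by rewrite mem_enum.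
apply/ffunP=> i; rewrite [RHS]ffunE [in RHS]ffunE inordK; move: (y_ge0 i) (leS i); case: (_ i) => // n _.
Qed.

(** * Separating small coordinates from large ones *)

Section Extract.

Variable K : nat -> nat.
Hypothesis leK : forall b, (b + m * (nstates b).+1 <= K b)%N.

Definition thr k := iter k K 0.

(* Exceeding the threshold on a coordinate of J removes that coordinate from J. *)
Lemma extract J z : recurrent z -> livec z -> (forall i, 0 <= z i) ->
    (forall i, i \notin J -> (K (thr #|J|))%:Z <= z i) ->
  exists J' z', [/\ (#|J'| <= d)%N, recurrent z' /\ livec z', forall i, 0 <= z' i,
    forall i, i \notin J' -> (K (thr #|J'|))%:Z <= z' i
    & forall w, en J' z' w -> boxed (thr #|J'|) J' z' w].
Proof.
elim: {J}#|J| {-2}J (erefl #|J|) z => [|k IHk] J eqJ z rz lz z_ge0 z_big; last first.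
  set b := thr #|J| in z_big.
  have [st|nst] := EM (forall w, en J z w -> boxed b J z w).
    by exists J, z; split=> //; rewrite -[leqRHS]card_ord max_card.
  have [w ew nbw] : exists2 w, en J z w & ~~ boxed b J z w.
    apply: contrapT => nex; apply: nst => w ew; apply: contrapT => /negP nbw.
    by apply: nex; exists w.
  have [bw|[w1 [wa [w2 [i [le1 e1 iJ lt_i _]]]]]] := exceed b ew (fun i _ => z_ge0 i).
    by rewrite bw in nbw.
  have leKb := leK b.
  have le_m1 : (m * size w1 <= m * (nstates b).+1)%N by rewrite leq_mul2l le1 orbT.
  have e1T : en setT z w1.
    apply: en_ext e1 _ => j _ jJ; apply: le_trans (z_big _ jJ); rewrite lez_nat.
    by apply: leq_trans le_m1 (leq_trans (leq_addl _ _) leKb).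
  have eqJi : #|J :\ i| = k by move: (cardsD1 i J); rewrite iJ eqJ add1n => -[].
  apply: (IHk _ eqJi (z + disp w1)).
  - exact: recurrent_reach.
  - exact: livec_reach.
  - by move=> j; apply: en_ge0 e1T _ _; rewrite ?inE.
  (* The lower bound required outside [J :\ i] is the old box bound [b]: coordinate [i] has just
     exceeded it, and the others keep at least [b] of their [K b] during [w1]. *)
  - have bK : b = K (thr k) by rewrite /b eqJ.
    rewrite eqJi -bK => j; rewrite !inE negb_and negbK => /orP[/eqP ->|jJ].
      exact: ltW.
    by rewrite addfE; have := z_big _ jJ; have := disp_bound w1 j; lia.
exists J, z; split=> //; first by rewrite eqJ.
move=> w ew; have [//|[w1 [wa [w2 [i [_ _ iJ]]]]]] := exceed (thr #|J|) ew (fun i _ => z_ge0 i).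
by move: (cardsD1 i J); rewrite iJ eqJ.
Qed.

End Extract.

(** * Length bounds and combinations of cycle displacements *)

Definition tourlen b : nat := (nstates b * (2 * nstates b))%N.

Definition ncyc b : nat := ((2 * (m * nstates b)).+1 ^ d)%N.

(** Encodes all vectors with entries of size at most [m * nstates b], up to a shift that [cval]
    undoes. Displacements of short cycles are among them, so one finite type counts cycles for every
    [J] and configuration. *)
Definition cycle_index b := {ffun 'I_d -> 'I_(2 * (m * nstates b)).+1}.

Definition cval b (f : cycle_index b) : V := [ffun i => (f i)%:Z - (m * nstates b)%N%:Z].

Definition ymax b : nat :=
  dbound (cycle_index b) 'I_d (m * nstates b) (m * tourlen b).

Definition rlen b : nat := (tourlen b + (ncyc b * ymax b).+1 * nstates b)%N.

(** The first two summands let a run leave the box in [extract] and still keep [b]; the third pays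
    for firing a tour; the last covers the rounding error and one batch of realized cycles in
    [shift]. *)
Definition large b : nat :=
  (b + m * (nstates b).+1 + m * tourlen b + ncyc b * (m * (nstates b + rlen b)))%N.

Definition vcomb b (y : cycle_index b -> nat) : V := \sum_f cval f *+ y f.

Lemma card_cycle_index b : #|{: cycle_index b}| = ncyc b.
Proof. by rewrite card_ffun !card_ord. Qed.

Lemma cval_bound b (f : cycle_index b) i : `|cval f i| <= (m * nstates b)%N%:Z.
Proof. by rewrite ffunE; have := ltn_ord (f i); lia. Qed.

Lemma cval_onto b g : (forall i, `|g i| <= (m * nstates b)%N%:Z) ->
  exists f : cycle_index b, cval f = g.
Proof.
move=> leg; exists [ffun i => inord (absz (g i + (m * nstates b)%N%:Z))].
apply/ffunP=> i; rewrite !ffunE; have := leg i.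
by move: (g i) => k lek; rewrite inordK; lia.
Qed.

Lemma vcombE b (y : cycle_index b -> nat) i :
  vcomb y i = comb (fun f j => cval f j) y i.
Proof.
rewrite /vcomb sum_ffunE; apply: eq_bigr => f _.
by rewrite ffunMnE -mulr_natl natz.
Qed.

Lemma cyc_cval b J z g : cyc b J z g -> exists f : cycle_index b, cval f = g.
Proof.
case=> w [c [_ lec _ ->]]; apply: cval_onto => i; apply: le_trans (disp_bound _ _) _.
by rewrite lez_nat leq_mul2l lec orbT.
Qed.

Definition cyc_supp b J z (y : cycle_index b -> nat) :=
  forall f, (0 < y f)%N -> cyc b J z (cval f).

Lemma cyc_count b J z (gs : seq V) : (forall g, g \in gs -> cyc b J z g) ->
  exists2 y : cycle_index b -> nat, cyc_supp J z y & vcomb y = \sum_(g <- gs) g.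
Proof.
elim: gs => [|g gs IHgs] cyc_gs.
  by exists (fun=> 0%N) => //; rewrite big_nil /vcomb big1.
have [h h_gs|y supp_y eqy] := IHgs; first by apply: cyc_gs; rewrite inE h_gs orbT.
have cyc_g := cyc_gs g (mem_head _ _).
have [f0 eqg] := cyc_cval cyc_g.
exists (fun f => (f == f0) + y f)%N.
  move=> f; rewrite addn_gt0 => /orP[|/supp_y//].
  by case: eqP => // -> _; rewrite eqg.
rewrite big_cons -eqy /vcomb; under eq_bigr do rewrite mulrnDr.
rewrite big_split /=; congr (_ + _); rewrite (bigD1 f0) //= eqxx mulr1n eqg big1 ?addr0 //.
by move=> f /negPf ->.
Qed.

Lemma cyc_list b J z (y : cycle_index b -> nat) : cyc_supp J z y ->
  exists gs : seq V, [/\ forall g, g \in gs -> cyc b J z g,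
    \sum_(g <- gs) g = vcomb y & size gs = (\sum_f y f)%N].
Proof.
move=> supp_y.
exists (flatten [seq nseq (y f) (cval f) | f <- enum {: cycle_index b}]); split.
- move=> g /flatten_mapP[f _]; rewrite mem_nseq => /andP[yf_gt0 /eqP ->].
  exact: supp_y.
- rewrite big_flatten big_map big_enum /=; apply: eq_bigr => f _.
  by rewrite big_nseq iter_addr_0.
- rewrite size_flatten /shape -map_comp sumnE big_map big_enum /=.
  by apply: eq_bigr => f _; rewrite /= size_nseq.
Qed.

Lemma vcomb0 b J z (y : cycle_index b -> nat) i : cyc_supp J z y -> i \in J -> vcomb y i = 0.
Proof.
by move=> /cyc_list[gs [cyc_gs <- _]] iJ; apply: sum_cyc0 cyc_gs iJ.
Qed.

(* The system has one block of equations per set S of coordinates; its unknowns are the common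
   vector g and, for each S, the multiplicities of the cycles and the vector supported by S. *)
Definition unknown b : finType :=
  ('I_d + {set 'I_d} * cycle_index b + {set 'I_d} * 'I_d)%type.

Definition equation : finType := ({set 'I_d} * 'I_d)%type.

Definition sysbound b (c : nat) : nat := dbound (unknown b) equation (m * nstates b).+1 c.

(** The summands bound, in [descent_step], the part of [u] not absorbed by [q], the short rest of
    the run, the amount left out by [excess], and [g]. *)
Definition residue b : nat :=
  (m * (rk d).+1 + m * nstates b + large b + sysbound b 0)%N.

(** * Tours and closed walks with prescribed displacement *)

Section Stable.

Variables (b : nat) (J : {set 'I_d}) (x : V).
Hypothesis rec_x : recurrent x.
Hypothesis x_big : forall i, i \notin J -> (large b)%:Z <= x i.
Hypothesis stable : forall w, en J x w -> boxed b J x w.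

Local Notation N := (nstates b).

Lemma en_real w : en J x w -> (m * size w <= large b)%N -> en setT x w.
Proof.
move=> ew lew; apply: en_ext ew _ => i _ iJ; apply: le_trans (x_big iJ).
by rewrite lez_nat.
Qed.

Lemma there_and_back u : en J x u -> exists w r,
  [/\ en J x (w ++ r), (size (w ++ r) <= 2 * N)%N,
      forall i, i \in J -> disp (w ++ r) i = 0 & agree J (disp w) (disp u)].
Proof.
move=> eu; have [w [lew ew eqw]] := decomp_agree eu (stable eu).
have ewT : en setT x w.
  apply: en_real ew _; rewrite /large -!addnA; apply: leq_trans (leq_addl _ _).
  by apply: leq_trans (leq_addr _ _); rewrite leq_mul2l leqW ?orbT.
have [w1 ew1 eqw1] := rec_x ewT.
have ew1J : en J (x + disp w) w1 by apply: en_mono ew1; rewrite ?subsetT.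
have bw1 : boxed b J (x + disp w) w1.
  have := @stable (w ++ w1); rewrite en_cat boxed_cat ew => /(_ ew1J).
  by case/andP.
have [r [ler er eqr]] := decomp_agree ew1J bw1.
exists w, r; split.
- by rewrite en_cat ew.
- by rewrite size_cat; lia.
- by move=> i iJ; rewrite disp_cat addfE -eqr // -addfE eqw1 zerofE.
- by move=> i iJ; rewrite eqw.
Qed.

Definition closed w := en J x w /\ forall i, i \in J -> disp w i = 0.

Definition visits w u := exists w1 w2, w = w1 ++ w2 /\ agree J (disp w1) (disp u).

Lemma closed_cat w1 w2 : closed w1 -> closed w2 -> closed (w1 ++ w2).
Proof.
move=> [e1 z1] [e2 z2]; split=> [|i iJ]; last by rewrite disp_cat addfE z1 ?z2.
rewrite en_cat e1; apply: en_agree e2 => i iJ; by rewrite addfE z1 // addr0.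
Qed.

(** For each listed state that occurs, a round trip is prepended; it vanishes on [J], so the visits
    of the rest are kept. *)
Lemma tour_through (ss : seq {ffun 'I_d -> 'I_b.+1}) : exists w,
  [/\ closed w, (size w <= size ss * (2 * N))%N
    & forall u, en J x u -> state b J (x + disp u) \in ss -> visits w u].
Proof.
elim: ss => [|s ss [w [cw lew vw]]].
  by exists [::]; split=> //; split=> // i _; rewrite disp_nil zerofE.
have [[u eu eqs]|ns] := EM (exists2 u, en J x u & state b J (x + disp u) = s); last first.
  exists w; split=> //; first by rewrite /= mulSn; apply: leq_trans (leq_addl _ _).
  move=> u eu; rewrite inE => /predU1P[eqs|]; last exact: vw.
  by case: ns; exists u.
have [w' [r [ew' lew' c0 eqw']]] := there_and_back eu.
exists ((w' ++ r) ++ w); split.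
- exact: closed_cat.
- by rewrite size_cat /= mulSn leq_add.
move=> u' eu'; rewrite inE => /predU1P[eqs'|/(vw _ eu')[w1 [w2 [-> eq1]]]].
  exists w', (r ++ w); rewrite catA; split=> // i iJ; rewrite eqw' //.
  have := state_inj (boxed_last (stable eu)) (boxed_last (stable eu')) _ iJ.
  by rewrite eqs eqs' !addfE => /(_ erefl); lia.
exists ((w' ++ r) ++ w1), w2; rewrite catA; split=> // i iJ.
by rewrite disp_cat addfE c0 // add0r eq1.
Qed.

Definition covers w := forall u, en J x u -> visits w u.

Lemma tour : exists w, [/\ closed w, (size w <= tourlen b)%N & covers w].
Proof.
have [w [cw lew vw]] := tour_through (enum {: {ffun 'I_d -> 'I_b.+1}}).
exists w; split=> // [|u eu]; last by apply: vw; rewrite ?mem_enum.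
by rewrite -cardE card_state in lew.
Qed.

Lemma cat_split (w1 w2 u1 u2 : seq T) : w1 ++ w2 = u1 ++ u2 ->
  (exists2 r, w1 = u1 ++ r & u2 = r ++ w2) \/ (exists2 r, u1 = w1 ++ r & w2 = r ++ u2).
Proof.
elim: w1 u1 => [|t w1 IHw] [|t' u1] /=.
- by move=> ->; left; exists [::].
- by move=> ->; right; exists (t' :: u1).
- by move<-; left; exists (t :: w1).
- by case=> -> /IHw[] [r -> ->]; [left|right]; exists r.
Qed.

(** The cycle is spliced in where the tour visits its starting state. It vanishes on [J], so later
    prefixes of the tour still visit the same states. *)
Lemma insert_cycle w g : closed w -> covers w -> cyc b J x g ->
  exists w', [/\ closed w', covers w', disp w' = disp w + g & (size w' <= size w + N)%N].
Proof.
move=> [ew w0] cov [v [c [evc lec c0 ->]]].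
move: (evc); rewrite en_cat => /andP[ev ec].
have [w1 [w2 [eqw eqv]]] := cov v ev.
move: ew w0; rewrite eqw en_cat => /andP[e1 e2] w0.
have eqc : agree J (x + disp w1) (x + disp w1 + disp c).
  by move=> i iJ; rewrite [RHS]addfE c0 // addr0.
have dE : disp (w1 ++ c ++ w2) = disp (w1 ++ w2) + disp c.
  by rewrite !disp_cat addrCA addrC.
exists (w1 ++ c ++ w2); split=> //; last by rewrite !size_cat; lia.
- split=> [|i iJ]; last by rewrite dE addfE w0 ?c0.
  rewrite !en_cat e1 (en_agree _ ec) ?(en_agree eqc) //.
  by move=> i iJ; rewrite !addfE eqv.
- move=> u eu; have [u1 [u2 [eq12 equ]]] := cov u eu.
  rewrite eqw in eq12; case: (cat_split eq12) => [[r -> _]|[r eq1 ->]].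
    by exists u1, (r ++ c ++ w2); rewrite -!catA.
  exists (w1 ++ c ++ r), u2; rewrite -!catA; split=> // i iJ.
  by rewrite -equ // eq1 !disp_cat !addfE c0 // add0r.
Qed.

Lemma insert_cycles w (gs : seq V) : closed w -> covers w ->
    (forall g, g \in gs -> cyc b J x g) ->
  exists w', [/\ closed w', disp w' = disp w + \sum_(g <- gs) g
    & (size w' <= size w + size gs * N)%N].
Proof.
elim: gs w => [|g gs IHgs] w cw cov cyc_gs; first by exists w; rewrite big_nil addr0 addn0.
have [w1 [cw1 cov1 eq1 le1]] := insert_cycle cw cov (cyc_gs _ (mem_head _ _)).
have [|w2 [cw2 eq2 le2]] := IHgs w1 cw1 cov1.
  by move=> h h_gs; apply: cyc_gs; rewrite inE h_gs orbT.
exists w2; split=> //; first by rewrite eq2 eq1 big_cons addrA.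
by rewrite /= mulSn; lia.
Qed.

(* A tour returns to x after a real run, whose return path expresses minus the displacement of
   the tour by cycles: inserting these and one more cycle g into the tour leaves exactly g. *)
Lemma realize g : cyc b J x g ->
  exists w, [/\ en J x w, disp w = g & (size w <= rlen b)%N].
Proof.
move=> cyc_g; have [w0 [cw0 le0 cov0]] := tour; have [e0 z0] := cw0.
have e0T : en setT x w0.
  apply: en_real e0 _; apply: leq_trans (leq_addr _ _); apply: leq_trans (leq_addl _ _).
  by rewrite leq_mul2l le0 orbT.
have [r er eqr] := rec_x e0T.
have erJ : en J x r.
  apply: en_mono er => [|i iJ]; first exact: subsetT.
  by rewrite addfE z0 // addr0.
have [r' [gs [ler' er' eqr' cyc_gs]]] := decomp erJ (stable erJ).
(* The short rest [r'] is itself a cycle, because the tour, its return path and the cut cycles all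
   vanish on [J]; so the whole return displacement is a sum of cycles. *)
have cyc_r' : cyc b J x (disp r').
  exists [::], r'; split=> // i iJ; have /ffunP/(_ i) := eqr.
  by rewrite eqr' !addfE zerofE z0 // (sum_cyc0 cyc_gs iJ) add0r addr0.
have [|y supp_y eqy] := @cyc_count b J x (disp r' :: gs).
  by move=> h; rewrite inE => /predU1P[->|/cyc_gs].
rewrite big_cons -eqr' in eqy.
(* The return path has unknown length, but its displacement is opposite to that of the tour and
   hence bounded, so the multiplicities can be replaced by ones of at most [ymax b]. *)
have [|y' [ley' eqy' y'_small]] := small_sol (@cval_bound b) (c := (m * tourlen b)%N) (y := y).
  move=> i; rewrite -vcombE eqy; have /ffunP/(_ i) := eqr; rewrite addfE zerofE.
  have := disp_bound w0 i; have : (m * size w0 <= m * tourlen b)%N by rewrite leq_mul2l le0 orbT.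
  lia.
have supp_y' : cyc_supp J x y' by move=> f yf; apply: supp_y; apply: leq_trans (ley' f).
have [gs' [cyc_gs' eqgs' szgs']] := cyc_list supp_y'.
have [|w [cw eqw lew]] := @insert_cycles w0 (g :: gs') cw0 cov0.
  by move=> h; rewrite inE => /predU1P[->|/cyc_gs'].
exists w; split; first by case: cw.
  rewrite eqw big_cons eqgs'; have -> : vcomb y' = disp r.
    by rewrite -eqy; apply/ffunP=> i; rewrite !vcombE eqy'.
  by rewrite addrCA eqr addr0.
apply: leq_trans lew _; rewrite leq_add // leq_mul2r /= ltnS szgs'; apply/orP; right.
rewrite -card_cycle_index -sum_nat_const; exact: leq_sum.
Qed.

Lemma realize_list (y : cycle_index b -> nat) (ss : seq (cycle_index b)) :
    cyc_supp J x y -> (forall f, (y f <= 1)%N) ->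
  exists w, [/\ en J x w, disp w = \sum_(f <- ss) cval f *+ y f
    & (size w <= size ss * rlen b)%N].
Proof.
move=> supp_y y_le1; elim: ss => [|f ss [w [ew eqw lew]]].
  by exists [::]; rewrite big_nil disp_nil.
have [y0|y1] := posnP (y f).
  exists w; rewrite big_cons y0 mulr0n add0r /= mulSn; split=> //.
  exact: leq_trans (leq_addl _ _).
have [w' [ew' eqw' lew']] := realize (supp_y _ y1).
exists (w' ++ w); split.
- rewrite en_cat ew'; apply: en_agree ew => i iJ; rewrite addfE eqw'.
  by have [? [? [_ _ c0 ->]]] := supp_y _ y1; rewrite c0 // addr0.
- rewrite disp_cat big_cons eqw eqw'; congr (_ + _).
  by have -> : y f = 1%N by have := y_le1 f; lia.
- by rewrite size_cat /= mulSn leq_add.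
Qed.

(* Following the segment from z to z + vcomb y by rounding down keeps all intermediate points large. *)
Lemma shift z (y : cycle_index b -> nat) : agree J x z -> cyc_supp J x y ->
    (forall i, i \notin J -> (large b)%:Z <= z i) ->
    (forall i, i \notin J -> (large b)%:Z <= (z + vcomb y) i) ->
  exists2 w, en setT z w & disp w = vcomb y.
Proof.
(* As [n] exceeds every [y f], consecutive roundings differ by at most one copy of each cycle. *)
move=> eqz supp_y z_big zy_big; pose n := (\sum_f y f).+1.
pose fl (k : nat) (f : cycle_index b) := (k * y f %/ n)%N.
have ley f : (y f < n)%N by rewrite ltnS (bigD1 f) //= leq_addr.
have supp_fl k : cyc_supp J x (fl k).
  by move=> f flf; apply: supp_y; move: flf; rewrite /fl; case: (y f); rewrite ?muln0 ?div0n.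
have eqfln : fl n = y by apply/funext=> f; rewrite /fl mulKn.
suff step k : (k <= n)%N -> exists2 w, en setT z w & disp w = vcomb (fl k).
  by have [//|w ew eqw] := step n; exists w; rewrite // eqw eqfln.
elim: k => [_|k IHk lt_kn].
  by exists [::]; rewrite // disp_nil /vcomb big1 // => f _; rewrite /fl mul0n div0n.
have [w ew eqw] := IHk (ltnW lt_kn).
pose dy f := (fl k.+1 f - fl k f)%N.
have mono f : (fl k f <= fl k.+1 f <= (fl k f).+1)%N.
  rewrite leq_div2r ?leq_mul2r ?leqnSn ?orbT //=.
  have -> : ((fl k f).+1 = (k * y f + n) %/ n)%N by rewrite divnDr ?divnn ?addn1.
  by rewrite leq_div2r // mulSn addnC leq_add2l ltnW.
have [|f|v [ev eqv lev]] := @realize_list dy (enum {: cycle_index b}).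
- move=> f dyf; apply: (supp_fl k.+1); rewrite /dy in dyf; lia.
- have := mono f; rewrite /dy; lia.
have eqvc : disp v = vcomb dy by rewrite eqv big_enum.
exists (w ++ v); last first.
  rewrite disp_cat eqw eqvc /vcomb -big_split /=; apply: eq_bigr => f _.
  by rewrite -mulrnDr /dy subnKC //; have /andP[] := mono f.
rewrite en_cat ew; apply: (@en_ext J).
  by apply: en_agree ev => i iJ; rewrite addfE eqw (vcomb0 (supp_fl k) iJ) addr0 eqz.
move=> i _ iJ; rewrite addfE eqw.
have := floor_comb (@cval_bound b) k y i (ltn0Sn (\sum_f y f)); rewrite -/n -!vcombE.
rewrite card_cycle_index -[vcomb (fun f => (k * y f %/ n)%N)]/(vcomb (fl k)).
have zi := z_big _ iJ; have zyi := zy_big _ iJ; rewrite addfE in zyi.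
have lemv : (m * size v <= ncyc b * (m * rlen b))%N.
  by rewrite mulnCA leq_mul2l -card_cycle_index cardE lev orbT.
have lebig : (ncyc b * (m * rlen b) + ncyc b * (m * N) <= large b)%N.
  by rewrite /large !mulnDr; lia.
move: (vcomb (fl k) i) (vcomb y i) (z i) zi zyi => e1 e2 zi lezi lezyi fl_e.
rewrite -(ler_pM2l (_ : 0 < n%:Z)) //.
(* The point [z + (k / n) vcomb y] is a convex combination of two endpoints that are at least
   [large b] outside [J]. *)
have : n%:Z * (large b)%:Z <= (n%:Z - k%:Z) * zi + k%:Z * (zi + e2).
  have -> : n%:Z * (large b)%:Z = (n%:Z - k%:Z) * (large b)%:Z + k%:Z * (large b)%:Z by ring.
  by rewrite lerD // ler_wpM2l //; lia.
move: (ncyc b * (m * N))%N (ncyc b * (m * rlen b))%N lebig lemv fl_e => p q lebig lemv fl_e.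
nia.
Qed.

(** * Descent to a small live configuration *)

Definition excess z i : nat := if i \in J then 0 else absz (z i - (large b)%:Z).

(* The excess of z can be traded along cycles for a vector supported by S, up to a bounded residue. *)
Definition tradable z (S : {set 'I_d}) (y : cycle_index b -> nat) (q : 'I_d -> nat) :=
  cyc_supp J x y /\ forall i,
    `|(excess z i)%:Z + vcomb y i - (i \in S)%:Z * (q i)%:Z| <= (residue b)%:Z.

(* The equations of the blocks outside R are multiplied by 0. *)
Definition coef (R : {set {set 'I_d}}) (u : unknown b) (e : equation) : int :=
  (e.1 \in R)%:Z * match u with
  | inl (inl i) => (i == e.2)%:Z
  | inl (inr (X, f)) => (X == e.1)%:Z * cval f e.2
  | inr (X, i) => - ((X == e.1) && (i == e.2) && (i \in X))%:Z
  end.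

Definition assemble (h : 'I_d -> nat) (y : {set 'I_d} -> cycle_index b -> nat)
    (q : {set 'I_d} -> 'I_d -> nat) (u : unknown b) : nat :=
  match u with
  | inl (inl i) => h i
  | inl (inr (X, f)) => y X f
  | inr (X, i) => q X i
  end.

Lemma coef_bound R u e : `|coef R u e| <= (m * N).+1%:Z.
Proof.
rewrite /coef; case: (e.1 \in R); last by rewrite mul0r.
rewrite mul1r; case: u => [[i|[X f]]|[X i]]; try by do ?case: (_ == _); do ?case: (_ \in _).
by case: (X == e.1); rewrite ?mul1r ?mul0r ?normr0 //; have := cval_bound f e.2; lia.
Qed.

Lemma comb_assemble R (w : unknown b -> nat) S i :
  comb (coef R) w (S, i) = (S \in R)%:Z *
    ((w (inl (inl i)))%:Z + vcomb (fun f => w (inl (inr (S, f)))) i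
     - (i \in S)%:Z * (w (inr (S, i)))%:Z).
Proof.
rewrite /comb big_sumType big_sumType /= mulrBr mulrDr; congr (_ + _ + _).
- rewrite (bigD1 i) //= big1 ?addr0 => [|j /negPf neq_ji]; rewrite /coef /=.
    by rewrite eqxx mulr1 mulrC.
  by rewrite neq_ji !mulr0.
- rewrite vcombE /comb mulr_sumr.
  transitivity (\sum_(p : {set 'I_d} * cycle_index b)
      (w (inl (inr (p.1, p.2))))%:Z * coef R (inl (inr (p.1, p.2))) (S, i)).
    by apply: eq_bigr => -[].
  rewrite -(pair_bigA _ (fun S' f => (w (inl (inr (S', f))))%:Z * coef R (inl (inr (S', f))) (S, i))).
  rewrite (bigD1 S) //= [X in _ + X]big1 ?addr0 => [|S' /negPf neq]; last first.
    by apply: big1 => f _; rewrite /coef /= neq mul0r !mulr0.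
  by apply: eq_bigr => f _; rewrite /coef /= eqxx mul1r mulrCA.
- transitivity (\sum_(p : {set 'I_d} * 'I_d)
      (w (inr (p.1, p.2)))%:Z * coef R (inr (p.1, p.2)) (S, i)).
    by apply: eq_bigr => -[].
  rewrite -(pair_bigA _ (fun S' j => (w (inr (S', j)))%:Z * coef R (inr (S', j)) (S, i))).
  rewrite (bigD1 S) //= [X in _ + X]big1 ?addr0 => [|S' /negPf neq]; last first.
    by apply: big1 => f _; rewrite /coef /= neq /= oppr0 !mulr0.
  rewrite (bigD1 i) //= [X in _ + X]big1 ?addr0 => [|j /negPf neq]; rewrite /coef /=.
    by rewrite !eqxx /=; ring.
  by rewrite eqxx neq /= oppr0 !mulr0.
Qed.

(** The run from [z - g] determines [S], but [g] must be fixed before it. One homogeneous solution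
    for all tradable sets at once supplies [g] together with an answer to each possible [S]. *)
Lemma descent_step z i0 : livec z -> agree J x z -> (forall i, 0 <= z i) ->
    (forall i, i \notin J -> (large b)%:Z <= z i) ->
    i0 \notin J -> (large b + sysbound b (residue b))%N%:Z < z i0 ->
  exists g, [/\ livec (z - g), agree J x (z - g), (forall i, 0 <= g i) /\ 0 < g i0,
    forall i, 0 <= (z - g) i & forall i, i \notin J -> (large b)%:Z <= (z - g) i].
Proof.
move=> lz eqz z_ge0 z_big i0J lt_i0.
pose R := [set S | `[< exists yq, tradable z S yq.1 yq.2 >]].
have [yq yqP] : exists yq, forall S, S \in R -> tradable z S (yq S).1 (yq S).2.
  have [S|yq yqP] := @choice {set 'I_d} ((cycle_index b -> nat) * ('I_d -> nat))%type
    (fun S p => S \in R -> tradable z S p.1 p.2); last by exists yq.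
  have [|nS] := boolP (S \in R); last by exists ((fun=> 0%N), (fun=> 0%N)).
  by rewrite inE => /asboolP[p pP]; exists p.
pose w0 := assemble (excess z) (fun S => (yq S).1) (fun S => (yq S).2).
have [||w [lew w_eq0 w_gt0 w_small]] :=
    @hom_sub _ _ (coef R) _ (coef_bound R) (residue b) w0 (inl (inl i0)).
- move=> [X i]; rewrite comb_assemble; have [XR|_] := boolP (X \in R); last by rewrite mul0r.
  by rewrite mul1r; case: (yqP X XR) => _; apply.
- rewrite /w0 /= /excess (negPf i0J) -/(sysbound b (residue b)); lia.
pose g : V := [ffun i => (w (inl (inl i)))%:Z].
have gE i : g i = (w (inl (inl i)))%:Z by rewrite ffunE.
have gJ i : i \in J -> g i = 0.
  by move=> iJ; rewrite gE; have := lew (inl (inl i)); rewrite /= /excess iJ; case: (w _).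
have g_le i : i \notin J -> g i <= z i - (large b)%:Z.
  move=> iJ; rewrite gE; have := lew (inl (inl i)); rewrite /= /excess (negPf iJ).
  by have := z_big i iJ; move: (z i) => zi; lia.
have g_small i : g i <= (sysbound b 0)%:Z by rewrite gE lez_nat; apply: w_small.
have g_ge0 i : 0 <= g i by rewrite gE.
have subE i : (z - g) i = z i - g i by rewrite addfE [X in _ + X]ffunE.
have z'_big i : i \notin J -> (large b)%:Z <= (z - g) i.
  by move=> iJ; rewrite subE; have := g_le i iJ; lia.
have z'_ge0 i : 0 <= (z - g) i.
  have [iJ|iJ] := boolP (i \in J); first by rewrite subE gJ // subr0.
  by apply: le_trans (z'_big i iJ).
have eqz' : agree J x (z - g) by move=> i iJ; rewrite subE gJ // subr0 eqz.
exists g; split=> //; last by split; rewrite // gE ltz_nat.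
move=> r er t; apply: contrapT => nex; set u := z - g + disp r in nex.
have unc v : ~~ en setT u (v ++ [:: t]) by apply/negP=> ev; apply: nex; exists v.
have u_ge0 i : 0 <= u i by apply: en_ge0 er _ _; rewrite ?inE.
pose S := [set i | (i \notin J) && ((m * (rk d).+1)%N%:Z <= u i)].
(* The run [r] itself shows that [S] is tradable for [z]: its cycles give [y], and [g] adds only a
   bounded error, since its bound [sysbound b 0] is part of [residue b]. *)
have SR : S \in R.
  rewrite inE; apply/asboolP.
  have erJ : en J x r by apply: en_mono er; rewrite ?subsetT // => i iJ; rewrite eqz'.
  have [r1 [gs [ler1 er1 eqr cyc_gs]]] := decomp erJ (stable erJ).
  have [y supp_y eqy] := cyc_count cyc_gs.
  exists (y, fun i => if i \in S then absz (u i - (m * (rk d).+1)%N%:Z) else 0%N); split=> //= i.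
  have [iJ|iJ] := boolP (i \in J).
    by rewrite /excess iJ (vcomb0 supp_y iJ) !inE iJ /= mul0r.
  have : u i = z i - g i + (disp r1 i + vcomb y i) by rewrite addfE subE eqr eqy addfE.
  rewrite /excess (negPf iJ) {1}[i \in S]inE iJ /=.
  have := z_big i iJ; have := g_small i; have := g_ge0 i; have := u_ge0 i; have := disp_bound r1 i.
  have : (m * size r1 <= m * N)%N by rewrite leq_mul2l ler1 orbT.
  have -> : (i \in S) = ((m * (rk d).+1)%N%:Z <= u i) by rewrite inE iJ.
  rewrite /residue; move: (m * (rk d).+1)%N (m * N)%N (m * size r1)%N (sysbound b 0) => B1 B2 B3 B4.
  move: (u i) (z i) (g i) (disp r1 i) (vcomb y i) => e1 e2 e3 e4 e5.
  by case: ifP; lia.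
pose y f := w (inl (inr (S, f))).
pose q : V := [ffun i => (i \in S)%:Z * (w (inr (S, i)))%:Z].
have qE i : q i = (i \in S)%:Z * (w (inr (S, i)))%:Z by rewrite ffunE.
have supp_y : cyc_supp J x y.
  have [supp _] := yqP S SR; move=> f yf; apply: supp; apply: leq_trans yf _.
  exact: (lew (inl (inr (S, f)))).
(* The block of [S] reads [g + vcomb y = q], so firing the cycles counted by [y] leads from [z] to
   [z - g + q], where [r] is still enabled. *)
have eqy : vcomb y = q - g.
  apply/ffunP=> i; have := w_eq0 (S, i); rewrite comb_assemble SR mul1r -gE -qE => /eqP.
  rewrite subr_eq0 -/y => /eqP eqgq.
  have -> : (q - g) i = q i - g i by rewrite addfE [X in _ + X]ffunE.
  by rewrite -eqgq addrC addKr.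
have q_ge0 i : 0 <= q i by rewrite qE mulr_ge0.
have zyE : z + vcomb y = z - g + q by rewrite eqy addrCA addrC.
have [i iJ|W eW dW] := shift eqz supp_y z_big.
  by rewrite zyE [leRHS]addfE; apply: le_trans (z'_big i iJ) _; rewrite lerDl.
have er' : en setT (z + disp W) r.
  rewrite dW zyE; apply: en_mono er => // i _.
  by rewrite [leRHS]addfE lerDl.
have [|v] := lz (W ++ r) _ t; first by rewrite en_cat eW.
have -> : z + disp (W ++ r) = u + q by rewrite disp_cat addrA dW zyE addrAC.
apply/negP; apply: uncoverable_raise => // i; rewrite qE.
by case: (boolP (i \in S)); rewrite ?mul0r // inE => /andP[].
Qed.

(** Each [descent_step] lowers the coordinate sum. It applies because an oversized coordinate lies
    outside [J]: on [J], [z] agrees with the boxed [x]. *)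
Lemma descent z : livec z -> agree J x z -> (forall i, 0 <= z i) ->
    (forall i, i \notin J -> (large b)%:Z <= z i) ->
  exists y, [/\ livec y, forall i, 0 <= y i
    & forall i, y i <= (large b + sysbound b (residue b))%N%:Z].
Proof.
have [n] := ubnP (\sum_i absz (z i))%N; elim: n z => // n IHn z; rewrite ltnS.
move=> le_n lz eqz z_ge0 z_big.
have inx : inbox b J x by apply: (boxed_head (stable (w := [::]) _)).
have [/forallP small|/forallPn[i]] :=
    boolP [forall i, z i <= (large b + sysbound b (residue b))%N%:Z]; first by exists z.
rewrite -ltNge => lt_i.
have iJ : i \notin J.
  apply/negP=> iJ; have /inboxP/(_ i iJ) := inx; rewrite eqz // => /andP[_ le_b].
  move: lt_i; rewrite ltNge (le_trans le_b) // lez_nat /large -!addnA leq_addr //.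
have [g [lzg eqzg [g_ge0 gi_gt0] zg_ge0 zg_big]] := descent_step lz eqz z_ge0 z_big iJ lt_i.
apply: (IHn (z - g)) => //; apply: leq_trans le_n.
have subE j : (z - g) j = z j - g j by rewrite addfE [X in _ + X]ffunE.
rewrite (bigD1 i) //= [X in (_ < X)%N](bigD1 i) //=.
rewrite -addSn; apply: leq_add; last apply: leq_sum => j _.
  have := zg_ge0 i; rewrite subE; move: gi_gt0 (z_ge0 i).
  by move: (z i) (g i) => e1 e2; lia.
have := zg_ge0 j; rewrite subE; move: (g_ge0 j) (z_ge0 j).
by move: (z j) (g j) => e1 e2; lia.
Qed.

End Stable.

Lemma small_live z : recurrent z -> livec z -> (forall i, 0 <= z i) ->
  exists k y, [/\ (k <= d)%N, livec y, forall i, 0 <= y i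
    & forall i, y i <= (large (thr large k) + sysbound (thr large k) (residue (thr large k)))%N%:Z].
Proof.
move=> rz lz z_ge0.
have [|//|J [x [leJ [rx lx] x_ge0 x_big stable]]] := @extract large _ setT z rz lz z_ge0.
- by move=> b; rewrite /large -!addnA leq_add2l leq_addr.
- by move=> i; rewrite inE.
exists #|J|; have [|y [ly y_ge0 y_le]] := @descent (thr large #|J|) J x rx x_big stable x lx _ x_ge0 x_big.
  by [].
by exists y.
Qed.

End Runs.

(** * Doubly exponential growth of the bounds *)

Section Growth.

Local Open Scope nat_scope.

(* The doubly exponential majorants: the class of functions of (b, m, d) below one of them is closed
   under everything that the bounds are built from. *)
Definition tower k b m d := (k + 2 + m + b) ^ (2 ^ ((d + 2) ^ k)).

Definition majorized (F : nat -> nat -> nat -> nat) :=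
  exists k, forall b m d, F b m d <= tower k b m d.

Lemma base_gt1 k m b : 1 < k + 2 + m + b. Proof. lia. Qed.

Lemma leq_tower k k' b b' m d : k <= k' -> b <= b' -> tower k b m d <= tower k' b' m d.
Proof.
move=> lek leb; apply: (@leq_trans ((k + 2 + m + b) ^ (2 ^ ((d + 2) ^ k')))).
  by rewrite leq_exp2l ?base_gt1 // leq_exp2l // leq_exp2l ?addn2.
by rewrite leq_exp2r ?expn_gt0 //; lia.
Qed.

Lemma base_le_tower k b m d : k + 2 + m + b <= tower k b m d.
Proof. by rewrite -[leqLHS]expn1 leq_exp2l ?base_gt1 // expn_gt0. Qed.

Lemma tower_gt1 k b m d : 1 < tower k b m d.
Proof. exact: leq_trans (base_gt1 k m b) (base_le_tower k b m d). Qed.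

Lemma double_pow_leq d k : ((d + 2) ^ k).*2 <= (d + 2) ^ k.+1.
Proof. by rewrite expnS -mul2n leq_mul2r leq_addl orbT. Qed.

Lemma tower_exp k j b m d : tower k b m d ^ (2 ^ ((d + 2) ^ j)) <= tower (maxn k j).+1 b m d.
Proof.
rewrite /tower -expnM -expnD; set n := maxn k j.
apply: (@leq_trans ((n.+1 + 2 + m + b) ^ (2 ^ ((d + 2) ^ k + (d + 2) ^ j)))).
  by rewrite leq_exp2r ?expn_gt0 //; have := leq_maxl k j; rewrite -/n; lia.
rewrite leq_exp2l ?base_gt1 // leq_exp2l //; apply: leq_trans (double_pow_leq d n).
by rewrite -addnn leq_add // leq_exp2l ?addn2 // ?leq_maxl ?leq_maxr.
Qed.

Lemma tower_mul k b m d : tower k b m d * tower k b m d <= tower k.+1 b m d.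
Proof.
have := tower_exp k 0 b m d; rewrite maxn0 expn0 => le_k.
exact: leq_trans le_k.
Qed.

Lemma tower_add k b m d : tower k b m d + tower k b m d <= tower k.+1 b m d.
Proof.
apply: leq_trans (tower_mul k b m d); rewrite addnn -mul2n leq_mul2r; exact/orP/or_intror/tower_gt1.
Qed.

Lemma tower_comp k b m d : tower k (tower k b m d) m d <= tower k.+2 b m d.
Proof.
apply: (@leq_trans ((tower k.+1 b m d) ^ (2 ^ ((d + 2) ^ k)))).
  rewrite {1}/tower leq_exp2r ?expn_gt0 //; apply: leq_trans (tower_add k b m d).
  by rewrite leq_add2r; apply: leq_trans (base_le_tower k b m d); rewrite leq_addr.
by apply: leq_trans (tower_exp k.+1 k b m d) _; rewrite (maxn_idPl (leqnSn k)).
Qed.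

Lemma majorized_le F G : (forall b m d, F b m d <= G b m d) -> majorized G -> majorized F.
Proof. by move=> leFG [k leG]; exists k => b m d; apply: leq_trans (leG b m d). Qed.

Lemma majorized2 F G : majorized F -> majorized G ->
  exists k, forall b m d, F b m d <= tower k b m d /\ G b m d <= tower k b m d.
Proof.
move=> [k1 leF] [k2 leG]; exists (maxn k1 k2) => b m d; split.
- by apply: leq_trans (leF b m d) _; rewrite leq_tower ?leq_maxl.
- by apply: leq_trans (leG b m d) _; rewrite leq_tower ?leq_maxr.
Qed.

Lemma majorized_add F G : majorized F -> majorized G ->
  majorized (fun b m d => F b m d + G b m d).
Proof.
move=> mF /(majorized2 mF)[k le_k]; exists k.+1 => b m d; apply: leq_trans (tower_add k b m d).
by have [? ?] := le_k b m d; apply: leq_add.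
Qed.

Lemma majorized_mul F G : majorized F -> majorized G ->
  majorized (fun b m d => F b m d * G b m d).
Proof.
move=> mF /(majorized2 mF)[k le_k]; exists k.+1 => b m d; apply: leq_trans (tower_mul k b m d).
by have [? ?] := le_k b m d; apply: leq_mul.
Qed.

Lemma majorized_const n : majorized (fun _ _ _ => n).
Proof. by exists n => b m d; apply: leq_trans (base_le_tower _ _ _ _); lia. Qed.

Lemma majorized_b : majorized (fun b _ _ => b).
Proof. by exists 0 => b m d; apply: leq_trans (base_le_tower _ _ _ _); lia. Qed.

Lemma majorized_m : majorized (fun _ m _ => m).
Proof. by exists 0 => b m d; apply: leq_trans (base_le_tower _ _ _ _); lia. Qed.

Lemma majorized_S F : majorized F -> majorized (fun b m d => (F b m d).+1).
Proof.
by move=> mF; apply: majorized_le (majorized_add mF (majorized_const 1)) => b m d; rewrite addn1.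
Qed.

Lemma majorized_exp F (e : nat -> nat) j : (forall d, e d <= 2 ^ ((d + 2) ^ j)) ->
  majorized F -> majorized (fun b m d => F b m d ^ e d).
Proof.
move=> le_e [k leF]; exists (maxn k j).+1 => b m d; apply: leq_trans (tower_exp k j b m d).
have [->|e_gt0] := posnP (e d); first by rewrite expn0 expn_gt0 (ltnW (tower_gt1 k b m d)).
apply: (@leq_trans (tower k b m d ^ e d)); first by rewrite leq_exp2r.
by rewrite leq_exp2l ?tower_gt1.
Qed.

Lemma leq_pow_d d : d <= 2 ^ ((d + 2) ^ 1).
Proof.
by rewrite expn1; apply: (@leq_trans (2 ^ d)); [exact/ltnW/ltn_expl | rewrite leq_exp2l ?leq_addr].
Qed.

(** The number [2 ^ d * d] is that of the equations indexed by [equation]. *)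
Lemma leq_pow_setd d : 2 ^ d * d <= 2 ^ ((d + 2) ^ 2).
Proof.
apply: (@leq_trans (2 ^ d * 2 ^ d)); first by rewrite leq_mul2l orbC ltnW // ltn_expl.
by rewrite -expnD leq_exp2l //; nia.
Qed.

Lemma majorized_pow_d F : majorized F -> majorized (fun b m d => F b m d ^ d).
Proof. exact: majorized_exp leq_pow_d. Qed.

Lemma majorized_pow_setd F : majorized F -> majorized (fun b m d => F b m d ^ (2 ^ d * d)).
Proof. exact: majorized_exp leq_pow_setd. Qed.

Lemma majorized_two_pow : majorized (fun _ _ d => 2 ^ d).
Proof. exact: majorized_pow_d (majorized_const 2). Qed.

Lemma majorized_d : majorized (fun _ _ d => d).
Proof. by apply: majorized_le majorized_two_pow => _ _ d; apply: ltnW; apply: ltn_expl. Qed.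

(** Each application at most multiplies the exponent by [2 * e], so at most [d] of them give
    [(2 * e) ^ d], whose binary logarithm [((d + 2) ^ k + 1) * d] is at most [(d + 2) ^ k.+2]. *)
Lemma majorized_iter F : majorized F ->
  exists k, forall n b m d, n <= d -> iter n (fun v => F v m d) b <= tower k b m d.
Proof.
move=> [k leF]; exists k.+2 => n b m d le_nd.
set X := k + 2 + m + b; set e := 2 ^ ((d + 2) ^ k).
have X_gt1 : 1 < X by apply: base_gt1.
apply: (@leq_trans (X ^ ((2 * e) ^ n))).
  elim: n {le_nd} => [|n IHn]; first by rewrite /X /= expn0 expn1 leq_addl.
  rewrite iterS; apply: leq_trans (leF _ _ _) _; rewrite expnSr expnM.
  set Y := X ^ _ in IHn *; rewrite /tower -/e [leqRHS]expnM -mulnn.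
  apply: (@leq_trans ((X + Y) ^ e)); first by rewrite leq_exp2r ?expn_gt0 // /X; lia.
  rewrite leq_exp2r ?expn_gt0 //.
  have leXY : X <= Y by rewrite /Y -[leqLHS]expn1 leq_exp2l // expn_gt0 muln_gt0 expn_gt0.
  nia.
apply: (@leq_trans ((k.+2 + 2 + m + b) ^ ((2 * e) ^ n))).
  by rewrite leq_exp2r ?expn_gt0 ?muln_gt0 ?expn_gt0 // /X; lia.
rewrite /tower leq_exp2l ?base_gt1 // -expnS -expnM leq_exp2l //.
apply: leq_trans (leq_mul (leqnn _) le_nd) _.
rewrite 2!expnSr; have : 0 < (d + 2) ^ k by rewrite expn_gt0 addn2.
move: ((d + 2) ^ k) => a; nia.
Qed.

Lemma poly_fun_pow k : poly_fun (fun d => (d + 2) ^ k).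
Proof.
exists (mkseq (fun i => 'C(k, i) * 2 ^ (k - i)) k.+1) => n.
rewrite size_mkseq addnC expnDn; apply: eq_bigr => i _.
by rewrite nth_mkseq ?ltn_ord // mulnA.
Qed.

Lemma majorized_nstates F : majorized F -> majorized (fun b m d => nstates d (F b m d)).
Proof. by move=> mF; apply: majorized_pow_d; apply: majorized_S. Qed.

Lemma rkE d m k : rk d m k = iter k (fun v => (nstates d (m * v.+1)).+1 + v) 0.
Proof. by elim: k => //= k ->. Qed.

Lemma majorized_rk : majorized (fun _ m d => rk d m d).
Proof.
have [|k le_k] := @majorized_iter (fun v m d => (nstates d (m * v.+1)).+1 + v).
  apply: majorized_add majorized_b; apply: majorized_S; apply: majorized_nstates.
  exact: majorized_mul majorized_m (majorized_S majorized_b).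
exists k => b m d; rewrite rkE; apply: leq_trans (le_k d 0 m d (leqnn d)) _.
exact: leq_tower.
Qed.

Lemma majorized_mN : majorized (fun b m d => m * nstates d b).
Proof. exact: majorized_mul majorized_m (majorized_nstates majorized_b). Qed.

Lemma majorized_ncyc : majorized (fun b m d => ncyc d m b).
Proof.
apply: majorized_pow_d; apply: majorized_S.
exact: majorized_mul (majorized_const 2) majorized_mN.
Qed.

Lemma majorized_tourlen : majorized (fun b m d => tourlen d b).
Proof.
have mN := majorized_nstates majorized_b.
exact: majorized_mul mN (majorized_mul (majorized_const 2) mN).
Qed.

Lemma majorized_ymax : majorized (fun b m d => ymax d m b).
Proof.
apply: (@majorized_le _
  (fun b m d => (2 * (m * tourlen d b + ncyc d m b * (m * nstates d b))).+1 ^ d)) => [b m d|].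
  by rewrite /ymax /dbound card_cycle_index card_ord.
apply: majorized_pow_d; apply: majorized_S; apply: majorized_mul (majorized_const 2) _.
apply: majorized_add; first exact: majorized_mul majorized_m majorized_tourlen.
exact: majorized_mul majorized_ncyc majorized_mN.
Qed.

Lemma majorized_rlen : majorized (fun b m d => rlen d m b).
Proof.
apply: majorized_add majorized_tourlen _.
apply: majorized_mul (majorized_nstates majorized_b); apply: majorized_S.
exact: majorized_mul majorized_ncyc majorized_ymax.
Qed.

Lemma majorized_big : majorized (fun b m d => large d m b).
Proof.
have mN := majorized_nstates majorized_b.
apply: majorized_add.
  apply: majorized_add; last exact: majorized_mul majorized_m majorized_tourlen.
  apply: majorized_add majorized_b _.
  exact: majorized_mul majorized_m (majorized_S mN).
apply: majorized_mul majorized_ncyc _; apply: majorized_mul majorized_m _.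
exact: majorized_add mN majorized_rlen.
Qed.

Lemma majorized_sysbound C : majorized C ->
  majorized (fun b m d => sysbound d m b (C b m d)).
Proof.
move=> mC; apply: (@majorized_le _ (fun b m d =>
    (2 * (C b m d + (d + 2 ^ d * ncyc d m b + 2 ^ d * d) * (m * nstates d b).+1)).+1
      ^ (2 ^ d * d))) => [b m d|].
  rewrite /sysbound /dbound !card_sum !card_prod card_cycle_index.
  by rewrite -!cardsT -!powersetT !card_powerset !cardsT !card_ord.
apply: majorized_pow_setd; apply: majorized_S; apply: majorized_mul (majorized_const 2) _.
apply: majorized_add mC _; apply: majorized_mul; last exact: majorized_S majorized_mN.
apply: majorized_add; last exact: majorized_mul majorized_two_pow majorized_d.
apply: majorized_add majorized_d _.
exact: majorized_mul majorized_two_pow majorized_ncyc.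
Qed.

Lemma majorized_residue : majorized (fun b m d => residue d m b).
Proof.
apply: majorized_add; last exact: majorized_sysbound (majorized_const 0).
apply: majorized_add majorized_big; apply: majorized_add majorized_mN.
exact: majorized_mul majorized_m (majorized_S majorized_rk).
Qed.

Lemma live_bound : exists k, forall j m d, j <= d ->
  large d m (thr (large d m) j) + sysbound d m (thr (large d m) j) (residue d m (thr (large d m) j))
    <= tower k 0 m d.
Proof.
have [k1 le1] := majorized_add majorized_big (majorized_sysbound majorized_residue).
have [k2 le2] := majorized_iter majorized_big.
exists (maxn k1 k2).+2 => j m d le_jd; apply: leq_trans (le1 _ _ _) _.
apply: leq_trans (tower_comp _ _ _ _); apply: leq_tower; first exact: leq_maxl.
apply: leq_trans (le2 j 0 m d le_jd) _; apply: leq_tower => //; exact: leq_maxr.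
Qed.

End Growth.

(** * From nets to integer-valued runs *)

Lemma In_tnth (X : Type) (s : seq X) a : In a s -> exists t, tnth (in_tuple s) t = a.
Proof.
elim: s => // h s IHs [->|/IHs[t <-]]; first by exists ord0.
by exists (lift ord0 t); rewrite !(tnth_nth h) lift0.
Qed.

Lemma tnth_In (X : Type) (s : seq X) t : In (tnth (in_tuple s) t) s.
Proof.
elim: s t => [[]//|h s IHs] t; have [j|] := unliftP ord0 t; last by move=> ->; left.
move=> ->; right; have := IHs j; congr In.
by rewrite !(tnth_nth h) lift0.
Qed.

Lemma netnorm_max d (A : net d) a : In a A -> (maxn (vnorm a.1) (vnorm a.2) <= netnorm A)%N.
Proof.
rewrite /netnorm; elim: A => //= h A IHA; rewrite big_cons => -[->|/IHA le_a]; first exact: leq_maxl.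
exact: leq_trans le_a (leq_maxr _ _).
Qed.

Section NetRuns.

Variables (d : nat) (A : net d).
Local Notation V := {ffun 'I_d -> int}.

Definition act (t : 'I_(size A)) : action d := tnth (in_tuple A) t.

Definition act_pre t : V := [ffun i => ((act t).1 i)%:Z].

Definition act_dl t : V := [ffun i => displacement (act t) i].

Definition emb (x : vec d) : V := [ffun i => (x i)%:Z].

Lemma act_pre_bound t i : 0 <= act_pre t i <= (netnorm A)%:Z.
Proof.
rewrite ffunE /= lez_nat; apply: leq_trans (leq_bigmax i) _.
by apply: leq_trans (netnorm_max (tnth_In t)); apply: leq_maxl.
Qed.

Lemma act_post_bound t i : 0 <= act_pre t i + act_dl t i <= (netnorm A)%:Z.
Proof.
rewrite !ffunE /displacement addrC subrK /= lez_nat; apply: leq_trans (leq_bigmax i) _.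
by apply: leq_trans (netnorm_max (tnth_In t)); apply: leq_maxr.
Qed.

Lemma emb_absz (z : V) : (forall i, 0 <= z i) -> emb (fun i => absz (z i)) = z.
Proof. by move=> z_ge0; apply/ffunP=> i; rewrite ffunE gez0_abs. Qed.

Lemma firable_emb t x : firable act_pre setT (emb x) t <-> forall i, ((act t).1 i <= x i)%N.
Proof.
split=> [/firableP fx i|lex]; first by have := fx i (in_setT i); rewrite !ffunE.
by apply/firableP=> i _; rewrite !ffunE lez_nat.
Qed.

Lemma step_run x y : step_net A x y ->
  exists2 t, firable act_pre setT (emb x) t & emb y = emb x + act_dl t.
Proof.
case=> a [inA [c [eqx eqy]]]; have [t eqa] := In_tnth inA; subst a; exists t.
  by apply/firable_emb => i; rewrite eqx leq_addl.
by apply/ffunP=> i; rewrite !ffunE eqx eqy /displacement /act !PoszD; ring.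
Qed.

Lemma reach_run x y : reach A x y ->
  exists2 w, en act_pre act_dl setT (emb x) w & emb y = emb x + disp act_dl w.
Proof.
elim=> {x y} [x y /step_run[t ft eqy]|x|x y z _ [w1 e1 eq1] _ [w2 e2 eq2]].
- by exists [:: t]; rewrite /= ?ft // disp_cons disp_nil addr0.
- by exists [::]; rewrite // disp_nil addr0.
- by exists (w1 ++ w2); rewrite ?en_cat ?e1 -?eq1 // disp_cat addrA -eq1.
Qed.

Lemma run_reach x w : en act_pre act_dl setT (emb x) w ->
  exists2 y, reach A x y & emb y = emb x + disp act_dl w.
Proof.
elim: w x => [|t w IHw] x /=; first by exists x; rewrite ?disp_nil ?addr0 //; apply: rt_refl.
case/andP=> /firable_emb lex ew; pose x1 : vec d := fun i => (x i - (act t).1 i + (act t).2 i)%N.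
have eqx1 : emb x1 = emb x + act_dl t.
  by apply/ffunP=> i; rewrite !ffunE /x1 /displacement; have := lex i; lia.
rewrite -eqx1 in ew; have [y rxy eqy] := IHw x1 ew.
exists y; last by rewrite eqy eqx1 disp_cons addrA.
apply: rt_trans rxy; apply: rt_step; exists (act t); split; first exact: tnth_In.
by exists (fun i => (x i - (act t).1 i)%N); split=> // i; rewrite subnK.
Qed.

Lemma live_livec x : live A x <-> livec act_pre act_dl (emb x).
Proof.
split=> [lx w /run_reach[x' rx' eqx'] t|lx a inA x' /reach_run[w ew eqx']]; last first.
  have [t eqa] := In_tnth inA; subst a.
  have [w'] := lx w ew t; rewrite -eqx' en_cat => /andP[/run_reach[y ry eqy]] /=.
  by rewrite andbT -eqy => /firable_emb ley; exists y.
have [y [/reach_run[w' ew' eqy] ley]] := lx (act t) (tnth_In t) x' rx'.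
exists w'; rewrite -eqx' en_cat ew' /= andbT -eqy; exact/firable_emb.
Qed.

End NetRuns.

Local Close Scope ring_scope.

Theorem theorem5 :
  exists f : nat -> nat -> nat, RB_function f /\
    forall (d : nat) (A : net d),
      structurally_live A -> conservative A ->
      exists x : vec d, live A x /\ vnorm x <= f (netnorm A) d.
Proof.
have [k le_k] := live_bound; exists (fun m d => tower k 0 m d); split.
  exists (k + 2)%N, (fun d => ((d + 2) ^ k)%N); split; first exact: poly_fun_pow.
  by move=> m d; rewrite /tower addn0.
move=> d A [x0 /live_livec lx0] [wt [wt_gt0 wt0]].
have x0_ge0 i : (0 <= emb x0 i)%R by rewrite ffunE.
(* The given live configuration need not be recurrent; a run leads to a recurrent one, which is
   still live. *)
have [|w ew rw] := conservative_recurrent (@act_post_bound d A) wt_gt0 _ x0_ge0.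
  move=> t; rewrite -[RHS](wt0 (act t) (tnth_In t)).
  by apply: eq_bigr => i _; rewrite ffunE.
have z_ge0 i : (0 <= (emb x0 + disp (@act_dl d A) w)%R i)%R.
  by apply: (en_ge0 (@act_post_bound d A) ew); rewrite ?inE.
have [j [y [le_jd ly y_ge0 y_le]]] :=
  small_live (@act_pre_bound d A) (@act_post_bound d A) rw (livec_reach lx0 ew) z_ge0.
exists (fun i => absz (y i)); split; first by apply/live_livec; rewrite emb_absz.
apply/bigmax_leqP => i _; apply: leq_trans (le_k j (netnorm A) d le_jd).
by have := y_le i; have := y_ge0 i; case: (y i).
Qed.
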